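(* Let $\Omega$, $g$, $\kappa$ satisfy hypotheses (H1)–(H4) listed in the context. Then the equation of prescribed Gaussian curvature (with the weak Dirichlet condition $u=g$ on $\partial\Omega$) has a strict classical super-solution; that is, there exist $w\in C^2(\bar\Omega)$ and $\mu>0$ such that $$F_*(x,w(x),\nabla w(x),D^2w(x))\ge\mu\qquad\text{for every }x\in\bar\Omega.$$
   Context: Hypotheses: (H1) $\Omega\subset\mathbb{R}^n$ is a uniformly convex, bounded, open domain. (H2) $g\in C^0(\partial\Omega)$. (H3) $\kappa:\bar\Omega\to[0,\infty)$ is continuous and bounded. (H4) $\int_\Omega\kappa(x)\,dx<\int_{\mathbb{R}^n}(1+|p|^2)^{-(n+2)/2}\,dp$. Operator: let $R(p)=(1+|p|^2)^{(n+2)/2}$, $\lambda_1(X)\le\dots\le\lambda_n(X)$ be the eigenvalues of a symmetric matrix $X$, $\det^+(X)=\prod_j\max\{\lambda_j(X),0\}$, and $G(x,p,X)=\max\{-\det^+(X)+\kappa(x)R(p),-\lambda_1(X)\}$. Then $F_*(x,z,p,X)=G(x,p,X)$ for $x\in\Omega$ and $F_*(x,z,p,X)=\min\{z-g(x),G(x,p,X)\}$ for $x\in\partial\Omega$. *)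

(* Defs.v *)
From HB Require Import structures.
From mathcomp Require Import all_boot all_order all_algebra.
From mathcomp Require Import all_classical all_reals all_analysis.
From mathcomp Require Import complex.

Set Implicit Arguments.
Unset Strict Implicit.
Unset Printing Implicit Defensive.
Import Order.TTheory GRing.Theory Num.Theory.
Import numFieldNormedType.Exports.

Local Open Scope classical_set_scope.
Local Open Scope ring_scope.

Definition borel_rV_display : Type -> measure_display.
Proof. exact. Qed.

Section borel_rV.
Variables (R : realType) (n : nat).

Let coord : 'I_n -> 'rV[R]_n -> measurableTypeR R := fun i x => x ord0 i.

Let rV0 : g_sigma_preimage coord set0.
Proof. exact: sigma_algebra0. Qed.

Let rVC A : g_sigma_preimage coord A -> g_sigma_preimage coord (~` A).
Proof. exact: sigma_algebraC. Qed.

Let rVU (F : _^nat) : (forall i, g_sigma_preimage coord (F i)) ->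
  g_sigma_preimage coord (\bigcup_i (F i)).
Proof. exact: sigma_algebra_bigcup. Qed.

HB.instance Definition _ := @isMeasurable.Build
  (borel_rV_display R) 'rV[R]_n (g_sigma_preimage coord) rV0 rVC rVU.

Lemma measurable_coord (i : 'I_n) :
  measurable_fun [set: 'rV[R]_n] (fun x => x ord0 i : measurableTypeR R).
Proof.
move=> _ Y mY; rewrite setTI; apply: sub_sigma_algebra => /=.
rewrite -bigcup_seq/=; exists i => /=; first by rewrite mem_index_enum.
by exists Y => //; rewrite setTI.
Qed.

Lemma measurable_rVP d (T : measurableType d) (f : T -> 'rV[R]_n) :
  (forall i, measurable_fun [set: T] (fun x => f x ord0 i : measurableTypeR R)) ->
  measurable_fun [set: T] f.
Proof.
move=> mf _ A; rewrite setTI.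
suff : (measurable : set (set 'rV[R]_n)) `<=` [set B | measurable (f @^-1` B)].
  exact.
apply: smallest_sub.
  split.
  - by rewrite /= preimage_set0.
  - by move=> B /= mB; rewrite setTD preimage_setC; exact: measurableC.
  - move=> F mF /=; rewrite preimage_bigcup.
    by apply: bigcup_measurable => k _; exact: mF.
rewrite -bigcup_seq => B [i _] [C mC <-] /=.
by rewrite setTI -[X in measurable X]setTI; exact: mf.
Qed.

End borel_rV.

Section lebesgue_rV.
Variable R : realType.

Definition cons_rV n (p : measurableTypeR R * 'rV[R]_n) : 'rV[R]_n.+1 :=
  row_mx (p.1%:M : 'M[R]_1) p.2.

Definition uncons_rV n (x : 'rV[R]_n.+1) : measurableTypeR R * 'rV[R]_n :=
  (x ord0 ord0, \row_i x ord0 (lift ord0 i)).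

Lemma cons_rV0 n p : cons_rV (n := n) p ord0 ord0 = p.1.
Proof.
rewrite /cons_rV (_ : ord0 = lshift n (ord0 : 'I_1)); last exact: val_inj.
by rewrite (@row_mxEl _ 1 1 n) mxE eqxx mulr1n.
Qed.

Lemma cons_rVS n p i : cons_rV (n := n) p ord0 (lift ord0 i) = p.2 ord0 i.
Proof.
rewrite /cons_rV (_ : lift ord0 i = rshift 1 i); last exact: val_inj.
by rewrite (@row_mxEr _ 1 1 n).
Qed.

Lemma uncons_rVK n : cancel (@uncons_rV n) (@cons_rV n).
Proof.
move=> x; apply/rowP => i; case: (unliftP ord0 i) => [j|] ->.
  by rewrite cons_rVS mxE.
by rewrite cons_rV0.
Qed.

Lemma cons_rVK n : cancel (@cons_rV n) (@uncons_rV n).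
Proof.
case=> a x; rewrite /uncons_rV cons_rV0; congr pair.
by apply/rowP => i; rewrite mxE cons_rVS.
Qed.

Lemma measurable_cons_rV n : measurable_fun setT (@cons_rV n).
Proof.
apply: measurable_rVP => i; case: (unliftP ord0 i) => [j|] ->.
  apply: (eq_measurable_fun (fun p : measurableTypeR R * 'rV[R]_n =>
    p.2 ord0 j : measurableTypeR R)).
    by move=> p _; rewrite cons_rVS.
  exact: (measurableT_comp (measurable_coord j) measurable_snd).
apply: (eq_measurable_fun fst) => [p _|]; first by rewrite cons_rV0.
exact: measurable_fst.
Qed.

Lemma measurable_uncons_rV n : measurable_fun setT (@uncons_rV n).
Proof.
apply/measurable_fun_pairP; split; first exact: measurable_coord.
apply: measurable_rVP => i.
apply: (eq_measurable_fun (fun x : 'rV[R]_n.+1 =>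
  x ord0 (lift ord0 i) : measurableTypeR R)); last exact: measurable_coord.
by move=> x _ /=; rewrite mxE.
Qed.

Section step.
Variables (n : nat) (m : {sigma_finite_measure set 'rV[R]_n -> \bar R}).

Definition lebesgue_step : set 'rV[R]_n.+1 -> \bar R :=
  pushforward ((@lebesgue_measure R) \x m)%E (@cons_rV n).

Let lebesgue_step0 : lebesgue_step set0 = 0%E.
Proof. by rewrite /lebesgue_step /pushforward preimage_set0 measure0. Qed.

Let lebesgue_step_ge0 A : (0 <= lebesgue_step A)%E.
Proof. by rewrite /lebesgue_step /pushforward measure_ge0. Qed.

Let lebesgue_step_sigma_additive : semi_sigma_additive lebesgue_step.
Proof.
move=> F mF tF mUF; rewrite /lebesgue_step /pushforward preimage_bigcup.
have mc := @measurable_cons_rV n.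
apply: measure_semi_sigma_additive.
- by move=> k; rewrite -[X in measurable X]setTI; exact: mc.
- apply/trivIsetP => /= i j _ _ ij; rewrite -preimage_setI.
  by move/trivIsetP : tF => /(_ _ _ _ _ ij) ->//; rewrite preimage_set0.
- by rewrite -preimage_bigcup -[X in measurable X]setTI; exact: mc.
Qed.

HB.instance Definition _ := isMeasure.Build _ _ _ lebesgue_step
  lebesgue_step0 lebesgue_step_ge0 lebesgue_step_sigma_additive.

Let lebesgue_step_sigma_finite : sigma_finite setT lebesgue_step.
Proof.
have /sigma_finiteP[F [TF ndF Foo]] :=
  sigma_finiteT (@lebesgue_measure R : {sigma_finite_measure set _ -> \bar R}).
have /sigma_finiteP[G [TG ndG Goo]] := sigma_finiteT m.
exists (fun k => @uncons_rV n @^-1` (F k `*` G k)).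
  rewrite -preimage_bigcup; apply/seteqP; split => // x _ /=.
  have : [set: measurableTypeR R] (x ord0 ord0) by [].
  have : [set: 'rV[R]_n] (uncons_rV x).2 by [].
  rewrite TF TG => -[l _ Gl] [k _ Fk]; exists (maxn k l) => //; split => /=.
    by have /subsetPset FF := ndF _ _ (leq_maxl k l); exact: FF.
  by have /subsetPset GG := ndG _ _ (leq_maxr k l); exact: GG.
move=> k; have [mF Fk] := Foo k; have [mG Gk] := Goo k.
have mFG : measurable (F k `*` G k) by exact: measurableX.
split.
  by rewrite -[X in measurable X]setTI; exact: measurable_uncons_rV.
rewrite /lebesgue_step /pushforward -comp_preimage.
rewrite (_ : _ \o _ = id); last by apply/funext => p /=; rewrite cons_rVK.
by rewrite preimage_id product_measure1E// lte_mul_pinfty// ge0_fin_numE.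
Qed.

HB.instance Definition _ := Measure_isSigmaFinite.Build _ _ _ lebesgue_step
  lebesgue_step_sigma_finite.

End step.

(* Lebesgue measure on R^n, obtained by transporting the n-fold product of the
   one-dimensional Lebesgue measure along (x_1, (x_2, ..., x_n)) |-> x *)
Fixpoint lebesgue_rV n : {sigma_finite_measure set 'rV[R]_n -> \bar R} :=
  if n is n'.+1 then lebesgue_step (lebesgue_rV n') else \d_(0 : 'rV[R]_0).

Lemma lebesgue_rV_box n (a b : 'I_n -> R) : (forall i, a i <= b i) ->
  lebesgue_rV n [set x | forall i, x ord0 i \in `[a i, b i]] =
  (\prod_(i < n) (b i - a i))%:E.
Proof.
elim: n a b => [|n IH] a b ab.
  rewrite big_ord0 /= diracE mem_set//= => i; by case: i.
have mbox k (c d : 'I_k -> R) :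
    measurable [set x : 'rV[R]_k | forall i, x ord0 i \in `[c i, d i]].
  rewrite (_ : [set x | _] = \bigcap_(i in [set: 'I_k])
      ((fun x : 'rV[R]_k => x ord0 i : measurableTypeR R)
         @^-1` [set` `[c i, d i]])).
    apply: fin_bigcap_measurable => // i _.
    by rewrite -[X in measurable X]setTI; exact: measurable_coord.
  apply/seteqP; split => [x /= h i _ /=|x h i]; first exact: h.
  exact: (h i).
rewrite big_ord_recl /= /lebesgue_step /pushforward.
have -> : @cons_rV n @^-1` [set x | forall i, x ord0 i \in `[a i, b i]] =
  ([set` `[a ord0, b ord0]] : set (measurableTypeR R)) `*`
  [set x : 'rV[R]_n |
    forall i, x ord0 i \in `[a (lift ord0 i), b (lift ord0 i)]].
  apply/seteqP; split => [p h|p [h1 h2] i].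
    split; first by have := h ord0; rewrite cons_rV0.
    by move=> i; have := h (lift ord0 i); rewrite cons_rVS.
  by case: (unliftP ord0 i) => [j|] ->; rewrite ?cons_rVS ?cons_rV0.
rewrite product_measure1E//; last exact: mbox.
rewrite EFinM; congr (_ * _)%E.
  have := lebesgue_measure_itv `[a ord0, b ord0]; rewrite /= lte_fin => ->.
  case: ltP => // ba; suff -> : a ord0 = b ord0 by rewrite subrr.
  by apply/eqP; rewrite eq_le ab ba.
exact: (IH (fun i => a (lift ord0 i)) (fun i => b (lift ord0 i))).
Qed.

End lebesgue_rV.

Section eigenvalues.
Variables (R : realType) (n : nat).
Implicit Type X : 'M[R]_n.

(* the real eigenvalues with multiplicity, in nondecreasing order: entry j is
   lambda_(j+1)(X). The sequence is [::] if the characteristic polynomial does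
   not split over R, which never happens for symmetric X
   (eigenvalues_symmetric) *)
Definition eigenvalues X : seq R :=
  sort <=%R (xget [::] [set s | char_poly X = \prod_(a <- s) ('X - a%:P)]).

Definition lambda_min X : R := (eigenvalues X)`_0.

Definition det_plus X : R := \prod_(j < n) Num.max (eigenvalues X)`_j 0.

Let char_poly_similar (C : numClosedFieldType) (P : 'M[C]_n) (d : 'rV[C]_n) :
  P \in unitmx ->
  char_poly (invmx P *m diag_mx d *m P) = \prod_i ('X - (d ord0 i)%:P).
Proof.
move=> uP; transitivity (char_poly (diag_mx d)).
  rewrite /char_poly /char_poly_mx !map_mxM /=.
  set Q := map_mx polyC P; set Q' := map_mx polyC (invmx P).
  have Q'Q : Q' *m Q = 1%:M by rewrite -map_mxM mulVmx// map_mx1.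
  have QQ' : Q *m Q' = 1%:M by rewrite -map_mxM mulmxV// map_mx1.
  set D := map_mx polyC _.
  have -> : 'X%:M - Q' *m D *m Q = Q' *m ('X%:M - D) *m Q.
    by rewrite mulmxBr mulmxBl mul_mx_scalar -scalemxAl Q'Q scalemx1.
  by rewrite !det_mulmx mulrAC -det_mulmx Q'Q det1 mul1r.
rewrite char_poly_trig ?diag_mx_is_trig//.
by apply: eq_bigr => i _; rewrite mxE eqxx mulr1n.
Qed.

Lemma eigenvalues_symmetric X : X^T = X ->
  char_poly X = \prod_(a <- eigenvalues X) ('X - a%:P) /\
  size (eigenvalues X) = n.
Proof.
move=> symX.
have [s sP] : exists s : seq R, char_poly X = \prod_(a <- s) ('X - a%:P).
  pose toC := real_complex R; pose Y := map_mx toC X.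
  have hY : Y \is hermsymmx.
    apply: realsym_hermsym.
      apply/is_hermitianmxP; rewrite expr0 scale1r; apply/matrixP => i j.
      by rewrite !mxE /= -[in LHS]symX mxE.
    apply/mxOverP => i j; rewrite mxE.
    by rewrite complex_real.
  move: (hermitian_spectral_diag_real hY)
    (orthomx_spectralP (hermitian_normalmx hY)) (spectral_unit Y).
  move: (spectral_diag Y) (spectralmx Y) => d P /mxOverP rd eY uP.
  exists [seq complex.Re (d ord0 i) | i <- enum 'I_n].
  apply: (map_poly_inj toC); rewrite map_char_poly -/Y eY.
  rewrite char_poly_similar// big_map rmorph_prod big_enum/=.
  apply: eq_bigr => i _; rewrite rmorphB /= map_polyX map_polyC /=.
  by congr (_ - _%:P); rewrite /toC /= RRe_real.
have eE : char_poly X = \prod_(a <- eigenvalues X) ('X - a%:P).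
  rewrite /eigenvalues; case: xgetP => [t _ tP|/(_ s)//].
  by rewrite [LHS]tP; apply: perm_big; rewrite perm_sym perm_sort.
split=> //; apply: succn_inj.
by rewrite -(size_char_poly X) eE size_prod_XsubC.
Qed.

End eigenvalues.

Section domains.
Variables (R : realType) (n : nat).
Implicit Types (Omega : set 'rV[R]_n) (p : 'rV[R]_n).

(* the library norm on 'rV[R]_n is the sup norm, hence this squared Euclidean
   norm *)
Definition sqnorm p : R := \sum_(i < n) p ord0 i ^+ 2.

Definition boundary Omega := closure Omega `\` interior Omega.

Definition domain Omega := [/\ open Omega, connected Omega & Omega !=set0].

(* Uniform convexity without smoothness of the boundary: for a fixed radius r,
   each boundary point lies on a sphere of radius r whose ball contains Omega.
   For a C^2 boundary this says that the principal curvatures are bounded below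
   by 1 / r > 0. *)
Definition uniformly_convex Omega :=
  convex_set (Omega : set (convex_lmodType 'rV[R]_n)) /\
  exists2 r : R, 0 < r &
    forall x, boundary Omega x -> exists c : 'rV[R]_n,
      sqnorm (x - c) = r ^+ 2 /\
      (forall y, Omega y -> sqnorm (y - c) <= r ^+ 2).

End domains.

Section C2.
Variables (R : realType) (n : nat).
Implicit Types (Omega : set 'rV[R]_n) (w : 'rV[R]_n -> R).

Definition basis_rV (i : 'I_n) : 'rV[R]_n := delta_mx ord0 i.

Definition grad w (x : 'rV[R]_n) : 'rV[R]_n := \row_i 'D_(basis_rV i) w x.

Definition hess w (x : 'rV[R]_n) : 'M[R]_n :=
  \matrix_(i, j) 'D_(basis_rV i) ('D_(basis_rV j) w) x.

Definition extends_continuously (T : topologicalType) Omega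
    (f : 'rV[R]_n -> T) :=
  exists2 fbar : 'rV[R]_n -> T,
    {within closure Omega, continuous fbar} & {in Omega, f =1 fbar}.

(* w is C^2 in Omega, and w, its gradient and its Hessian extend continuously to
   the closure; continuity of the derivatives in Omega is part of
   extends_continuously *)
Definition C2_closure Omega w :=
  [/\ {within closure Omega, continuous w},
      forall x, Omega x -> forall i, derivable w x (basis_rV i),
      forall x, Omega x -> forall i j,
        derivable ('D_(basis_rV j) w) x (basis_rV i),
      extends_continuously Omega (grad w) &
      extends_continuously Omega (hess w)].

(* the value at x in the closure of Omega of the continuous extension of
   f restricted to Omega (closure_limE) *)
Definition closure_lim (T : ptopologicalType) Omega (f : 'rV[R]_n -> T)
    (x : 'rV[R]_n) : T :=
  lim (f @ within Omega (nbhs x)).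

Lemma closure_limE (T : ptopologicalType) Omega (f fbar : 'rV[R]_n -> T) :
  hausdorff_space T ->
  {within closure Omega, continuous fbar} -> {in Omega, f =1 fbar} ->
  forall x, closure Omega x -> closure_lim Omega f x = fbar x.
Proof.
move=> hT cf ff x cx.
have PF : ProperFilter (within Omega (nbhs x)).
  apply: Build_ProperFilter_ex => A /= /cx [y [Oy Ay]].
  by exists y; exact: Ay.
apply: cvg_lim => //.
have fbarx : fbar @ within (closure Omega) (nbhs x) --> fbar x.
  by move/subspace_continuousP : cf; exact.
move=> A /fbarx; rewrite /fmap /= !nbhs_simpl /within /=.
apply: filterS => y yA Oy; rewrite ff ?inE//; apply: yA.
exact: subset_closure.
Qed.

Definition gradbar Omega w := closure_lim Omega (grad w).

Definition hessbar Omega w := closure_lim Omega (hess w).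

End C2.

Section gauss_curvature.
Variables (R : realType) (n : nat).
Implicit Types (Omega : set 'rV[R]_n) (g kappa : 'rV[R]_n -> R).
Implicit Types (x p : 'rV[R]_n) (z : R) (X : 'M[R]_n).

Definition curv_weight p : R := (1 + sqnorm p) `^ (n.+2%:R / 2).

Definition G_op kappa x p X : R :=
  Num.max (- det_plus X + kappa x * curv_weight p) (- lambda_min X).

Definition F_lower Omega g kappa x z p X : R :=
  if x \in Omega then G_op kappa x p X
  else Num.min (z - g x) (G_op kappa x p X).

End gauss_curvature.

(* Main.v *)
Require Import Defs.
From mathcomp Require Import all_boot all_order all_algebra.
From mathcomp Require Import all_classical all_reals all_analysis.
From mathcomp Require Import ring lra.

Import Order.TTheory GRing.Theory Num.Theory.
Import numFieldNormedType.Exports.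

(** The operator [G_op] is the maximum of the curvature defect and of
    [- lambda_min X], so it is at least 1 at any function whose Hessian has an
    eigenvalue at most -1, whatever its gradient: a strict super-solution may
    simply be concave.  The concave paraboloid [C - |x|^2 / 2], whose Hessian is
    [- 1] times the identity everywhere, is therefore a strict super-solution
    with [mu = 1], provided that it also exceeds [g] by 1 on the boundary.  The
    boundary of a bounded set is compact and [g + |x|^2 / 2] is continuous on
    it, hence bounded above, so a large enough [C] achieves this. *)

Local Open Scope classical_set_scope.
Local Open Scope ring_scope.

(** Both a coordinate of [x] and [sqnorm x] restrict to polynomials of degree at
    most 2 on every line, so all the derivatives of the paraboloid are read off
    an expansion of this form. *)
Lemma is_derive_quadratic {R : realType} {V : normedModType R} (f : V -> R)
  (x v : V) (a b : R) :
  (forall h : R, f (h *: v + x) = f x + h * a + h ^+ 2 * b) ->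
  is_derive x v f a.
Proof.
move=> fE; set q := fun h : R => h^-1 *: (f (h *: v + x) - f x).
have qE : {near 0^', (fun h => a + h * b) =1 q}.
  near=> h; rewrite /q fE.
  have h0 : h != 0 by near: h; exact: nbhs_dnbhs_neq.
  by rewrite /GRing.scale /=; field.
have lin_cvg : a + h * b @[h --> (0 : R)] --> a + 0 * b.
  apply: cvgD; first exact: cvg_cst.
  by apply: cvgM; [exact: cvg_id | exact: cvg_cst].
have qa : q @ 0^' --> a.
  rewrite mul0r addr0 in lin_cvg.
  apply: cvg_trans (near_eq_cvg qE) _.
  exact: cvg_within_filter lin_cvg.
by split; [apply/cvg_ex; exists a | apply: cvg_lim].
Unshelve. all: by end_near. Qed.

Section paraboloid.
Context {R : realType} {n : nat}.
Implicit Types (C : R) (x : 'rV[R]_n).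

Definition paraboloid C x : R := C - sqnorm x / 2.

Lemma is_derive_paraboloid C x (i : 'I_n) :
  is_derive x (basis_rV R i) (paraboloid C) (- x ord0 i).
Proof.
apply: (@is_derive_quadratic _ _ _ _ _ _ (- 2^-1)) => h.
rewrite /paraboloid /sqnorm (bigD1 i)//= [in RHS](bigD1 i)//=.
rewrite (eq_bigr (fun j => x ord0 j ^+ 2)) => [|j ji].
  by rewrite !mxE !eqxx /=; field.
by rewrite !mxE (negbTE ji) andbF mulr0 add0r.
Qed.

Lemma derive_paraboloid C (i : 'I_n) :
  'D_(basis_rV R i) (paraboloid C) = (fun x => - x ord0 i).
Proof. by apply/funext => x; have [] := is_derive_paraboloid C x i. Qed.

Lemma is_derive2_paraboloid C x (i j : 'I_n) :
  is_derive x (basis_rV R i) ('D_(basis_rV R j) (paraboloid C))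
    (- (i == j)%:R).
Proof.
rewrite derive_paraboloid.
apply: (@is_derive_quadratic _ _ _ _ _ _ 0) => h.
by rewrite !mxE /= eq_sym; ring.
Qed.

Lemma hess_paraboloid C : hess (paraboloid C) = cst (- 1)%:M.
Proof.
apply/funext => x; apply/matrixP => i j; rewrite !mxE.
have [_ ->] := is_derive2_paraboloid C x i j.
by rewrite -mulNrn.
Qed.

Lemma sqnorm_continuous : continuous (@sqnorm R n).
Proof.
move=> x; rewrite /sqnorm.
apply: (cvg_big add_continuous (nbhs_filter x)) => i _.
by apply: cvgM; exact: coord_continuous.
Qed.

Lemma paraboloid_continuous C : continuous (paraboloid C).
Proof.
move=> x; apply: (@continuousB _ _ _ (cst C) (fun y => sqnorm y / 2)).
  exact: cst_continuous.
apply: (@continuousM _ _ (@sqnorm R n) (cst 2^-1)); last exact: cst_continuous.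
exact: sqnorm_continuous.
Qed.

Lemma C2_closure_paraboloid Omega C : C2_closure Omega (paraboloid C).
Proof.
split.
- exact/continuous_subspaceT/paraboloid_continuous.
- by move=> x _ i; have [] := is_derive_paraboloid C x i.
- by move=> x _ i j; have [] := is_derive2_paraboloid C x i j.
- exists (fun x => - x) => [|x _].
    exact/continuous_subspaceT/opp_continuous.
  apply/rowP => i; rewrite !mxE.
  by have [_ ->] := is_derive_paraboloid C x i.
- exists (cst (- 1)%:M) => [|x _]; last by rewrite hess_paraboloid.
  exact/continuous_subspaceT/cst_continuous.
Qed.

Lemma hessbar_paraboloid Omega C x : closure Omega x ->
  hessbar Omega (paraboloid C) x = (- 1)%:M.
Proof.
move=> clx; rewrite /hessbar hess_paraboloid.
have hM : hausdorff_space 'M[R]_n by exact: norm_hausdorff.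
pose k : 'rV[R]_n -> 'M[R]_n := cst (- 1)%:M.
have ck : {within closure Omega, continuous k}.
  exact/continuous_subspaceT/cst_continuous.
exact: (@closure_limE R n _ Omega k k hM ck (fun _ _ => erefl) x clx).
Qed.

End paraboloid.

(** The eigenvalue sequence is a chosen splitting of the characteristic
    polynomial, so its entries are known only as roots of it; for [a%:M] the only
    root is [a]. *)
Lemma lambda_min_scalar {R : realType} {n : nat} (a : R) : (0 < n)%N ->
  lambda_min (a%:M : 'M[R]_n) = a.
Proof.
move=> n0; set X := a%:M.
have [chE szE] := @eigenvalues_symmetric R n X (tr_scalar_mx _ _).
have : root (char_poly X) (lambda_min X).
  by rewrite chE root_prod_XsubC mem_nth// szE.
rewrite char_poly_trig ?scalar_mx_is_trig//.
rewrite (eq_bigr (fun=> 'X - a%:P)) => [|i _]; last by rewrite !mxE eqxx.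
rewrite prodr_const card_ord rootE horner_exp expf_eq0 n0 -rootE.
by rewrite root_XsubC => /eqP.
Qed.

Lemma bounded_closure {R : realType} {V : normedModType R} {A : set V} :
  bounded_set A -> bounded_set (closure A).
Proof.
move=> [M [Mr AM]]; exists M; split => // y /AM Ay.
rewrite closureE /=; apply: smallest_sub => //.
apply: (@preimage_closed _ _ (fun z : V => `|z|) [set z | z <= y]).
  by move=> z _; exact: norm_continuous.
exact: closed_le.
Qed.

Lemma compact_boundary {R : realType} {n : nat} {Omega : set 'rV[R]_n} :
  bounded_set Omega -> compact (boundary Omega).
Proof.
move=> bO; apply: bounded_closed_compact.
  have [M [Mr HM]] := bounded_closure bO.
  by exists M; split => // y /HM yP x [/yP].
rewrite /boundary setDE; apply: closedI; first exact: closed_closure.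
exact/open_closedC/open_interior.
Qed.

Theorem lemma42 (R : realType) (n : nat) (hn : (0 < n)%N)
  (Omega : set 'rV[R]_n) (g kappa : 'rV[R]_n -> R)
  (Omega_domain : domain Omega)
  (Omega_bounded : bounded_set Omega)
  (Omega_convex : uniformly_convex Omega)
  (g_continuous : {within boundary Omega, continuous g})
  (kappa_ge0 : forall x, closure Omega x -> 0 <= kappa x)
  (kappa_continuous : {within closure Omega, continuous kappa})
  (kappa_bounded : exists M : R, forall x, closure Omega x -> kappa x <= M)
  (kappa_small :
    (\int[lebesgue_rV R n]_(x in Omega) (kappa x)%:E <
     \int[lebesgue_rV R n]_p ((1 + sqnorm p) `^ (- (n.+2%:R / 2)))%:E)%E) :
  exists (w : 'rV[R]_n -> R) (mu : R),
    [/\ C2_closure Omega w, 0 < mu &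
      forall x, closure Omega x ->
        mu <= F_lower Omega g kappa x (w x) (gradbar Omega w x)
                (hessbar Omega w x)].
Proof.
have cB := compact_boundary Omega_bounded.
pose f x := g x - paraboloid 0 x.
have cf : {within boundary Omega, continuous f}.
  move=> x; apply: (@continuousB _ _ (subspace (boundary Omega))).
    exact: g_continuous.
  exact: (continuous_subspaceT (paraboloid_continuous 0)).
have /compact_bounded[M [_ HM]] := continuous_compact cf cB.
have fM x : boundary Omega x -> f x <= M + 1.
  move=> Bx; apply: le_trans (ler_norm _) _.
  by apply: (HM (M + 1)); [rewrite ltrDl | exists x].
(* C = M + 2 leaves room for mu = 1 above the bound M + 1 for g + |x|^2 / 2. *)
exists (paraboloid (M + 2)), 1; split => //.
  exact: C2_closure_paraboloid.
move=> x clx.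
have G1 p : 1 <= G_op kappa x p (hessbar Omega (paraboloid (M + 2)) x).
  by rewrite /G_op hessbar_paraboloid// lambda_min_scalar// opprK le_max lexx orbT.
rewrite /F_lower; case: ifPn => [_|/negP xO]; first exact: G1.
rewrite le_min G1 andbT /paraboloid.
have : boundary Omega x.
  by split=> // /interior_subset Ox; apply: xO; rewrite inE.
by move/fM; rewrite /f /paraboloid; lra.
Qed.
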